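(* Let $p_1\neq p_2$ be prime numbers. For $i=1,2$, let $K_i$ be a $p_i$-adic field and let $f_i(x)=x+O(x^2)$ be an analytic function over $K_i$ with $f_i(x)\neq x$. Then the $f_i$ are not locally homeomorphic. That is, there is no homeomorphism $h:U_1\to U_2$ with $h(0)=0$ and $h\circ f_1=f_2\circ h$, where $U_i$ are $f_i$-invariant neighborhoods of $0$ in $K_i$ (contained in the domain of convergence of $f_i$).
   Context: For a prime $p$, a $p$-adic field is a complete non-archimedean valued field $(K,|\cdot|)$ of characteristic zero with $|p|<1$, normalized so that $|p|=1/p$. A power series is analytic (at $0$) if it has positive radius of convergence. ''$f_i(x)\ne x$'' means that $f_i$ is not the identity power series. *)

(* Defs.v *)
From HB Require Import structures.
From mathcomp Require Import all_boot all_order all_algebra.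
From mathcomp Require Import all_classical all_reals all_analysis.

Set Implicit Arguments.
Unset Strict Implicit.
Unset Printing Implicit Defensive.

Import Order.TTheory GRing.Theory Num.Theory.
Import numFieldNormedType.Exports.

Local Open Scope classical_set_scope.
Local Open Scope ring_scope.

(* MathComp's normed structures cannot be used here: their norms satisfy
   `|x *+ n| = `|x| *+ n, which fails for a non-archimedean absolute value. *)
Record valuedField (R : realType) := ValuedField {
  valued_field :> fieldType ;
  vabs : valued_field -> R ;
  vabs_ge0 : forall x, 0 <= vabs x ;
  vabs_eq0 : forall x, (vabs x == 0) = (x == 0) ;
  vabsM : forall x y, vabs (x * y) = vabs x * vabs y ;
  vabs_ultra : forall x y, vabs (x + y) <= Num.max (vabs x) (vabs y)
}.

(* K with the topology and uniform structure of the distance |x - y|. *)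
Definition valued_space {R : realType} (K : valuedField R) : Type := K.

Section ValuedSpace.
Context {R : realType} (K : valuedField R).
Implicit Types x y z : K.

Lemma vabs0 : vabs (0 : K) = 0.
Proof. by apply/eqP; rewrite vabs_eq0. Qed.

Lemma vabsN x : vabs (- x) = vabs x.
Proof.
apply/eqP; rewrite -(@eqrXn2 _ 2) ?vabs_ge0//.
by rewrite !expr2 -!vabsM mulrNN.
Qed.

Let dist (x y : valued_space K) : R := vabs ((x : K) - (y : K)).

Let distxx x : dist x x = 0.
Proof. by rewrite /dist subrr vabs0. Qed.

Let dist_positivity x y : dist x y = 0 -> x = y.
Proof. by move=> /eqP; rewrite vabs_eq0 subr_eq0 => /eqP. Qed.

Let dist_sym x y : dist x y = dist y x.
Proof. by rewrite /dist -vabsN opprB. Qed.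

Let dist_triangle y x z : dist x z <= dist x y + dist y z.
Proof.
rewrite /dist -(subrKA y) (le_trans (vabs_ultra _ _))//.
by rewrite ge_max lerDl lerDr !vabs_ge0.
Qed.

HB.instance Definition _ := Choice.copy (valued_space K) (K : choiceType).
HB.instance Definition _ := isPointed.Build (valued_space K) (0 : K).
HB.instance Definition _ := @isMetric.Build R (valued_space K) dist
  distxx dist_positivity dist_sym dist_triangle.

Lemma ball_valuedE (x : valued_space K) (e : R) :
  ball x e = [set y | vabs ((x : K) - (y : K)) < e].
Proof. by []. Qed.

End ValuedSpace.

Section PadicField.
Context {R : realType}.

Definition complete_field (K : valuedField R) : Prop :=
  forall F : set_system (valued_space K), ProperFilter F -> cauchy F -> cvg F.

Definition padic_field (p : nat) (K : valuedField R) : Prop :=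
  [/\ prime p, complete_field K, [pchar K] =i pred0
    & vabs (p%:R : K) = (p%:R : R)^-1].

End PadicField.

(* A power series \sum_n f n * x ^+ n is given by its coefficients f. *)
Section PowerSeries.
Context {R : realType} {K : valuedField R}.
Implicit Types (f : nat -> K) (x : valued_space K).

Definition ps_partial f x : nat -> valued_space K :=
  series (fun n => f n * (x : K) ^+ n).

Definition ps_domain f : set (valued_space K) :=
  [set x | cvgn (ps_partial f x)].

(* Meaningful only for x in [ps_domain f]. *)
Definition ps_eval f x : valued_space K := limn (ps_partial f x).

(* Over a complete non-archimedean field, a series converges iff its terms
   tend to 0. *)
Definition ps_radius f : \bar R :=
  ereal_sup [set r%:E | r in
    [set r : R | 0 <= r /\ vabs (f n) * r ^+ n @[n --> \oo] --> (0 : R)]].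

Definition analytic f : Prop := (0 < ps_radius f)%E.

Definition ps_id : nat -> K := fun n => (n == 1)%:R.

(* f(x) = x + O(x^2) *)
Definition tangent_to_id f : Prop := f 0%N = 0 /\ f 1%N = 1.

(* U need not be open, and invariance means f(U) `<=` U. *)
Definition invariant_nbhs0 f (U : set (valued_space K)) : Prop :=
  [/\ nbhs ((0 : K) : valued_space K) U, U `<=` ps_domain f
    & set_fun U U (ps_eval f)].

End PowerSeries.
Arguments ps_id {R K}.

Definition homeomorphism_between {T1 T2 : topologicalType}
    (U1 : set T1) (U2 : set T2) (h : T1 -> T2) : Prop :=
  exists g : T2 -> T1,
    [/\ set_bij U1 U2 h, {in U1, cancel h g},
        {within U1, continuous h} & {within U2, continuous g}].

Definition locally_homeomorphic {R : realType} {K1 K2 : valuedField R}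
    (f1 : nat -> K1) (f2 : nat -> K2) : Prop :=
  exists (U1 : set (valued_space K1)) (U2 : set (valued_space K2))
         (h : valued_space K1 -> valued_space K2),
    [/\ invariant_nbhs0 f1 U1, invariant_nbhs0 f2 U2,
        homeomorphism_between U1 U2 h, h (0 : K1) = (0 : K2)
      & {in U1, forall x, h (ps_eval f1 x) = ps_eval f2 (h x)}].

(* Main.v *)
(** Write f(x) = x + g(x). On a small enough ball around 0, f is a self-map and
    g is 1/2-Lipschitz. Since g(f^j x) = g(x) up to an error of size |g(x)|/2,
    summing over j < p gives |f^p(x) - x| <= |f(x) - x|/2 in a p-adic field, and
    f^p - id is again 1/2-Lipschitz; hence f^(p^n) converges uniformly to the
    identity and m |-> f^m(y) is continuous for the p-adic topology on the
    exponents. A conjugacy h carries f1^(p1^n)(x) --> x to f2^(p1^n)(y) --> y.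
    But p1^n is p2-adically close to 1 for suitable large n (Euler), so that the
    same iterates also come close to f2(y). Thus f2(y) = y for all y near 0,
    and f2 is the identity power series. *)
Require Import Defs.
From mathcomp Require Import all_boot all_order all_algebra.
From mathcomp Require Import all_classical all_reals all_analysis.
From mathcomp Require Import cyclic ring lra.

Set Implicit Arguments.
Unset Strict Implicit.
Unset Printing Implicit Defensive.

Import Order.TTheory GRing.Theory Num.Theory.
Import numFieldNormedType.Exports.

Local Open Scope classical_set_scope.
Local Open Scope ring_scope.

Lemma exists_half_expr_lt (R : realType) (e : R) :
  0 < e -> exists N, forall n, (N <= n)%N -> 2^-1 ^+ n < e.
Proof.
move=> e0.
have h : `|2^-1 : R| < 1 by rewrite ger0_norm; lra.
have /cvgrPdist_lt/(_ e e0)[N _ HN] := cvg_expr h.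
exists N => n /HN /=.
by rewrite sub0r normrN ger0_norm// exprn_ge0//; lra.
Qed.

(** * Ultrametric estimates *)

Section Ultrametric.
Context {R : realType} {K : valuedField R}.
Implicit Types x y z : K.

Lemma vabs1 : vabs (1 : K) = 1.
Proof.
have n0 : vabs (1 : K) != 0 by rewrite vabs_eq0 oner_eq0.
by apply: (mulfI n0); rewrite -vabsM !mulr1.
Qed.

Lemma vabsX x n : vabs (x ^+ n) = vabs x ^+ n.
Proof. by elim: n => [|n IH]; rewrite ?expr0 ?vabs1// !exprS vabsM IH. Qed.

Lemma vabsD_le x y b : vabs x <= b -> vabs y <= b -> vabs (x + y) <= b.
Proof. by move=> xb yb; rewrite (le_trans (vabs_ultra _ _))// ge_max xb. Qed.

Lemma vabsD_lt x y b : vabs x < b -> vabs y < b -> vabs (x + y) < b.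
Proof. by move=> xb yb; rewrite (le_lt_trans (vabs_ultra _ _))// gt_max xb. Qed.

Lemma vabs_sum_le (I : Type) (r : seq I) (P : pred I) (F : I -> K) b :
  0 <= b -> (forall i, P i -> vabs (F i) <= b) ->
  vabs (\sum_(i <- r | P i) F i) <= b.
Proof.
move=> b0 Fb; elim/big_ind: _ => //; first by rewrite vabs0.
by move=> x y; exact: vabsD_le.
Qed.

Lemma vabs_natr_le1 n : vabs (n%:R : K) <= 1.
Proof.
elim: n => [|n IH]; first by rewrite vabs0.
by rewrite -addn1 natrD; apply: vabsD_le; rewrite ?vabs1.
Qed.

(** After factoring out [x - y], every summand of the cofactor has absolute value at most [s ^+ n];
    the ultrametric inequality avoids a factor [n.+1]. *)
Lemma vabs_subX_le x y s n : vabs x <= s -> vabs y <= s ->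
  vabs (x ^+ n.+1 - y ^+ n.+1) <= vabs (x - y) * s ^+ n.
Proof.
move=> xs ys; have s0 : 0 <= s := le_trans (vabs_ge0 x) xs.
rewrite subrXX vabsM ler_wpM2l ?vabs_ge0//.
apply: vabs_sum_le => [|i _]; first exact: exprn_ge0.
rewrite /= vabsM !vabsX -[X in s ^+ X](subnK (leq_ord i)) exprD.
by rewrite ler_pM ?exprn_ge0 ?vabs_ge0// lerXn2r// nnegrE vabs_ge0.
Qed.

(** If the absolute value [d] of the limit exceeded [b], then for some [n] it would be that of a sum
    of three terms, each smaller than [d]. *)
Lemma vabs_lim_le (u v : nat -> valued_space K) (l m : valued_space K)
    (c : K) (b : R) : u @ \oo --> l -> v @ \oo --> m ->
  (\forall n \near \oo, vabs ((u n : K) - (v n : K) - c) <= b) ->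
  vabs ((l : K) - (m : K) - c) <= b.
Proof.
move=> ul vm uvb; rewrite leNgt; apply/negP => blt.
have d0 : 0 < vabs ((l : K) - (m : K) - c).
  apply: le_lt_trans blt.
  have [n] := @filter_ex _ _ _ _ uvb.
  exact: le_trans (vabs_ge0 _).
have un : \forall n \near \oo, ball l (vabs ((l : K) - (m : K) - c)) (u n).
  exact: ul (nbhsx_ballx l _ d0).
have vn : \forall n \near \oo, ball m (vabs ((l : K) - (m : K) - c)) (v n).
  exact: vm (nbhsx_ballx m _ d0).
have [n [[/= + +] uvn]] := @filter_ex _ _ _ _ (filterI (filterI un vn) uvb).
rewrite !ball_valuedE /= => lu mv.
have : vabs (((l : K) - (u n : K)) + ((v n : K) - (m : K))
    + ((u n : K) - (v n : K) - c)) < vabs ((l : K) - (m : K) - c).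
  apply: vabsD_lt; last exact: le_lt_trans blt.
  by apply: vabsD_lt => //; rewrite -vabsN opprB.
by rewrite (_ : _ + _ = (l : K) - (m : K) - c) ?ltxx//; ring.
Qed.

End Ultrametric.

(** * Iterating a map close to the identity *)

Section NearIdentity.
Context {R : realType} {K : valuedField R}.
Variable rho : R.
Implicit Types (F : K -> K) (x y : K).

(** The constant 1/2 suits every prime, since 1/p is at most 1/2. *)
Definition near_id F : Prop :=
  (forall x, vabs x <= rho -> vabs (F x) <= rho) /\
  (forall x y, vabs x <= rho -> vabs y <= rho ->
    vabs ((F x - x) - (F y - y)) <= 2^-1 * vabs (x - y)).

Lemma near_id_contract F x y : near_id F -> vabs x <= rho -> vabs y <= rho ->
  vabs (F x - F y) <= vabs (x - y).
Proof.
move=> [_ FL] xr yr.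
rewrite (_ : F x - F y = ((F x - x) - (F y - y)) + (x - y));
  last by ring.
apply: vabsD_le => //; rewrite (le_trans (FL _ _ _ _))//.
by have := vabs_ge0 (x - y); lra.
Qed.

(** Displacements of successive iterates add up, and an ultrametric sum of 1/2-Lipschitz maps is
    again 1/2-Lipschitz. *)
Lemma near_id_iter F n : near_id F -> near_id (iter n F).
Proof.
move=> FI; elim: n => [|n IH].
  by split=> // x y _ _; rewrite /= !subrr vabs0 mulr_ge0 ?vabs_ge0.
split=> [x xr|x y xr yr]; first by apply: FI.1; apply: IH.1.
rewrite !iterS; set u := iter n F x; set v := iter n F y.
rewrite (_ : _ - _ = ((F u - u) - (F v - v)) + ((u - x) - (v - y)));
  last by ring.
apply: vabsD_le; last exact: IH.2.
apply: le_trans (FI.2 _ _ (IH.1 _ xr) (IH.1 _ yr)) _.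
by rewrite ler_wpM2l//; exact: near_id_contract IH _ _.
Qed.

(** The two bounds are coupled: the first at [n] gives the second at [n], as integers have absolute
    value at most 1, and the second controls the new error in the first at [n.+1]. *)
Lemma near_id_iter_sub F n x : near_id F -> vabs x <= rho ->
  vabs (iter n F x - x - n%:R * (F x - x)) <= 2^-1 * vabs (F x - x) /\
  vabs (iter n F x - x) <= vabs (F x - x).
Proof.
move=> FI xr; have d0 := vabs_ge0 (F x - x).
have second m : vabs (iter m F x - x - m%:R * (F x - x))
    <= 2^-1 * vabs (F x - x) -> vabs (iter m F x - x) <= vabs (F x - x).
  move=> H; rewrite -(subrK (m%:R * (F x - x)) (iter m F x - x)).
  apply: vabsD_le; first by apply: le_trans H _; lra.
  by rewrite vabsM ler_piMl// vabs_natr_le1.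
suff H : vabs (iter n F x - x - n%:R * (F x - x)) <= 2^-1 * vabs (F x - x).
  by split=> //; exact: second.
elim: n => [|n IH].
  by rewrite /= subrr mul0r subr0 vabs0; lra.
rewrite iterS -addn1 natrD; set u := iter n F x.
rewrite (_ : _ - _ = ((F u - u) - (F x - x)) + (u - x - n%:R * (F x - x)));
  last by ring.
apply: vabsD_le => //.
apply: le_trans (FI.2 _ _ ((near_id_iter n FI).1 _ xr) xr) _.
by rewrite ler_wpM2l//; exact: second.
Qed.

Variable p : nat.
Hypothesis p_prime : prime p.
Hypothesis vabs_p : vabs (p%:R : K) = (p%:R : R)^-1.

(** For [n = p] the main term [p%:R * (F x - x)] also shrinks, by the factor 1/p. *)
Lemma near_id_iter_prime F x : near_id F -> vabs x <= rho ->
  vabs (iter p F x - x) <= 2^-1 * vabs (F x - x).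
Proof.
move=> FI xr; rewrite -(subrK (p%:R * (F x - x)) (iter p F x - x)).
apply: vabsD_le; first by have [] := near_id_iter_sub p FI xr.
rewrite vabsM vabs_p ler_wpM2r ?vabs_ge0// lef_pV2 ?posrE ?ltr0n ?prime_gt0//.
by rewrite ler_nat prime_gt1.
Qed.

Lemma near_id_iter_pX F n x : near_id F -> vabs x <= rho ->
  vabs (iter (p ^ n) F x - x) <= 2^-1 ^+ n * rho.
Proof.
move=> FI xr; elim: n => [|n IH].
  rewrite expn0 expr0 mul1r; apply: vabsD_le; first exact: FI.1.
  by rewrite vabsN.
rewrite expnS iterM exprS -mulrA.
apply: le_trans (near_id_iter_prime (near_id_iter (p ^ n) FI) xr) _.
by rewrite ler_wpM2l.
Qed.

(** With [m = k * p ^ n + 1], the [m]-th iterate applies [iter (p ^ n) F] to [F x] [k] times, which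
    moves [F x] no further than a single application may. *)
Lemma near_id_iter_congr1 F m n x : near_id F -> vabs x <= rho ->
  (0 < m)%N -> m = 1 %[mod p ^ n] ->
  vabs (iter m F x - F x) <= 2^-1 ^+ n * rho.
Proof.
move=> FI xr m0 /eqP; rewrite eqn_mod_dvd// => /dvdnP[k mk].
rewrite -(subnK m0) addn1 mk iterSr iterM.
have Fxr := FI.1 _ xr.
apply: le_trans (near_id_iter_pX n FI Fxr).
exact: (near_id_iter_sub k (near_id_iter (p ^ n) FI) Fxr).2.
Qed.

End NearIdentity.

(** * Power series tangent to the identity *)

Section PowerSeries.
Context {R : realType} {K : valuedField R}.
Implicit Types (f : nat -> K) (x y : K).

(** The terms [vabs (f n) * r ^+ n] tend to 0 for some positive [r], hence are bounded; subtracting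
    [ps_id] alters only the coefficient of index 1, which becomes 0. *)
Lemma analytic_coef_bound f : analytic f -> tangent_to_id f ->
  exists r C : R, [/\ 0 < r, 0 < C &
    forall n, vabs (f n - ps_id n) <= C / r ^+ n].
Proof.
move=> /ereal_sup_gt[_ [r [_ fr] <-]]; rewrite lte_fin => r0 [_ f1].
have [M [_ HM]] := cvg_seq_bounded (cvgP _ fr).
exists r, (`|M| + 1); split=> //.
move=> n; rewrite ler_pdivlMr ?exprn_gt0//.
have M1 : M < `|M| + 1 by rewrite (le_lt_trans (ler_norm M))// ltrDl.
have := HM _ M1 n I; rewrite /= ger0_norm; last first.
  by rewrite mulr_ge0 ?vabs_ge0// exprn_ge0// ltW.
rewrite /ps_id; case: eqP => [-> _|_]; last by rewrite subr0.
by rewrite f1 subrr vabs0 mul0r addr_ge0.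
Qed.

Lemma ps_partial_subid f x n : (1 < n)%N ->
  (ps_partial f x n : K) - x = \sum_(k < n) (f k - ps_id k) * x ^+ k.
Proof.
move=> n1; rewrite /ps_partial /series /= big_mkord.
under [RHS]eq_bigr do rewrite mulrBl.
rewrite [RHS]sumrB; congr (_ - _).
rewrite (bigD1 (Ordinal n1))//= mul1r expr1 big1 ?addr0// => i.
by rewrite -val_eqE /= /ps_id => /negPf->; rewrite mul0r.
Qed.

(** The series of [f - ps_id] starts in degree 2, which yields the factor [s]: shrinking the ball
    makes the Lipschitz constant arbitrarily small. *)
Lemma ps_eval_subid_le f x y C r s : 0 < r -> 0 < C -> tangent_to_id f ->
  (forall n, vabs (f n - ps_id n) <= C / r ^+ n) ->
  vabs x <= s -> vabs y <= s -> s <= r ->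
  ps_domain f x -> ps_domain f y ->
  vabs (((ps_eval f x : K) - x) - ((ps_eval f y : K) - y))
    <= C / r ^+ 2 * s * vabs (x - y).
Proof.
move=> r0 C0 [f0 f1] fC xs ys sr xf yf.
have s0 : 0 <= s := le_trans (vabs_ge0 x) xs.
rewrite (_ : _ - _ = (ps_eval f x : K) - (ps_eval f y : K) - (x - y));
  last by ring.
apply: (vabs_lim_le xf yf); near=> n.
rewrite (_ : _ - _
    = ((ps_partial f x n : K) - x) - ((ps_partial f y n : K) - y));
  last by ring.
have n1 : (1 < n)%N by near: n; exists 2%N.
rewrite !ps_partial_subid// -sumrB.
have b0 : 0 <= C / r ^+ 2 * s * vabs (x - y).
  by rewrite !mulr_ge0 ?vabs_ge0 ?invr_ge0 ?exprn_ge0// ltW.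
apply: vabs_sum_le => // -[[|[|i]] ltin] _ /=; rewrite -mulrBr.
- by rewrite f0 [X in X * _]subrr mul0r vabs0.
- by rewrite f1 [X in X * _]subrr mul0r vabs0.
rewrite vabsM.
apply: le_trans
  (ler_pM (vabs_ge0 _) (vabs_ge0 _) (fC i.+2) (vabs_subX_le i.+1 xs ys)) _.
(* The bound for degree [i.+2] is the one for degree 2 times a power of [s / r], which is at most
   1. *)
rewrite [X in X <= _](_ : _ = C / r ^+ 2 * s * vabs (x - y) * (s / r) ^+ i).
  rewrite ler_piMr// exprn_ile1 ?divr_ge0 ?ler_pdivrMr ?mul1r//; exact: ltW.
rewrite expr_div_n !exprS; field.
by rewrite expf_neq0 ?gt_eqF.
Unshelve. all: by end_near. Qed.

Lemma analytic_near_id f (U : set (valued_space K)) :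
  analytic f -> tangent_to_id f ->
  nbhs ((0 : K) : valued_space K) U -> U `<=` ps_domain f ->
  exists rho : R, [/\ 0 < rho, forall x, vabs x <= rho -> U x &
    near_id rho (ps_eval f : K -> K)].
Proof.
move=> fa ft /nbhs_ballP[e /= e0 eU] Uf.
have [r [C [r0 C0 fC]]] := analytic_coef_bound fa ft.
(* The three bounds put the closed ball inside [U], allow the Lipschitz estimate, and make its
   constant at most 1/2. *)
pose rho := Num.min (e / 2) (Num.min r (r ^+ 2 / (2 * C))).
have rho0 : 0 < rho.
  by rewrite !lt_min r0 !divr_gt0 ?mulr_gt0 ?exprn_gt0.
have rho_e : rho <= e / 2 by rewrite ge_min lexx.
have rho_r : rho <= r by rewrite !ge_min lexx orbT.
have rho_C : C / r ^+ 2 * rho <= 2^-1.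
  have : rho <= r ^+ 2 / (2 * C) by rewrite !ge_min lexx !orbT.
  rewrite ler_pdivlMr ?mulr_gt0// => H.
  by rewrite mulrAC ler_pdivrMr ?exprn_gt0//; lra.
have ballU x : vabs x <= rho -> U x.
  move=> xr; apply: eU; rewrite ball_valuedE /= sub0r vabsN.
  by apply: le_lt_trans xr _; apply: le_lt_trans rho_e _; lra.
have lip x y : vabs x <= rho -> vabs y <= rho ->
    vabs (((ps_eval f x : K) - x) - ((ps_eval f y : K) - y))
      <= 2^-1 * vabs (x - y).
  move=> xr yr.
  have := ps_eval_subid_le r0 C0 ft fC xr yr rho_r
    (Uf _ (ballU _ xr)) (Uf _ (ballU _ yr)).
  by move=> /le_trans; apply; rewrite ler_wpM2r ?vabs_ge0.
exists rho; split=> //; split=> // x xr.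
have z0 : vabs (0 : K) <= rho by rewrite vabs0 ltW.
(* Comparing with the fixed point 0 turns the Lipschitz bound into the self-map property. *)
have f00 : ps_eval f (0 : K) = (0 : K).
  apply/eqP; rewrite -vabs_eq0 eq_le vabs_ge0 andbT.
  rewrite -[X in vabs X]subr0 -[X in vabs X]subr0.
  apply: (vabs_lim_le (Uf _ (ballU _ z0)) (cvg_cst (0 : valued_space K))).
  near=> n.
  have n1 : (1 < n)%N by near: n; exists 2%N.
  rewrite subr0 (ps_partial_subid _ _ n1) big1 ?vabs0// => -[[|i] ltin] _ /=.
    by rewrite ft.1 [X in X * _]subrr mul0r.
  by rewrite expr0n mulr0.
have := lip _ _ xr z0; rewrite f00 !subr0 => H.
rewrite -(subrK x (ps_eval f x : K)); apply: vabsD_le => //.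
by apply: le_trans H _; have := vabs_ge0 x; lra.
Unshelve. all: by end_near. Qed.

(** Identity principle: the first nonzero term of [f - ps_id] would dominate the rest of the series
    at a small nonzero point. *)
Lemma ps_eval_id_eq f rho p : prime p -> vabs (p%:R : K) = (p%:R : R)^-1 ->
  analytic f -> tangent_to_id f -> 0 < rho ->
  (forall x, vabs x <= rho -> ps_domain f x /\ ps_eval f x = x) ->
  f = ps_id.
Proof.
move=> p_prime vp fa ft rho0 fid.
have [r [C [r0 C0 fC]]] := analytic_coef_bound fa ft.
apply/funext => n; elim/ltn_ind: n => n IH.
apply/eqP; rewrite -subr_eq0 -vabs_eq0 -[_ == 0]negbK; apply/negP => cn0.
set c := vabs (f n - ps_id n) in cn0.
have c0 : 0 < c by rewrite lt_neqAle eq_sym cn0 vabs_ge0.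
(* Below the last bound, the tail bound [C / r ^+ n.+1 * vabs y ^+ n.+1] is smaller than
   [c * vabs y ^+ n]. *)
pose e := Num.min rho (Num.min r (c * r ^+ n.+1 / C)).
have e0 : 0 < e by rewrite !lt_min rho0 r0 divr_gt0 ?mulr_gt0 ?exprn_gt0.
have [m /(_ m (leqnn m)) me] := exists_half_expr_lt e0.
(* Powers of [p] supply nonzero points arbitrarily close to 0. *)
pose y : K := p%:R ^+ m.
have p0 : 0 < (p%:R : R) by rewrite ltr0n prime_gt0.
have y0 : 0 < vabs y by rewrite vabsX vp exprn_gt0 ?invr_gt0.
have ye : vabs y < e.
  apply: le_lt_trans me; rewrite vabsX vp lerXn2r ?nnegrE ?invr_ge0 ?(ltW p0)//.
  by rewrite lef_pV2 ?posrE// ler_nat prime_gt1.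
move: ye; rewrite !lt_min => /and3P[/ltW y_rho /ltW y_r].
rewrite ltr_pdivlMr// => y_c.
have [yf fy] := fid _ y_rho.
have b0 : 0 <= C / r ^+ n.+1 * vabs y ^+ n.+1.
  by rewrite !mulr_ge0 ?vabs_ge0 ?invr_ge0 ?exprn_ge0 ?vabs_ge0// ltW.
have : vabs ((ps_eval f y : K) - y - (f n - ps_id n) * y ^+ n)
    <= C / r ^+ n.+1 * vabs y ^+ n.+1.
  apply: (vabs_lim_le yf (cvg_cst (y : valued_space K))); near=> N.
  have N1 : (1 < N)%N by near: N; exists 2%N.
  have Nn : (n < N)%N by near: N; exists n.+1.
  rewrite (ps_partial_subid _ _ N1) (bigD1 (Ordinal Nn))//= addrAC subrr add0r.
  apply: vabs_sum_le => // i; rewrite -val_eqE /= => i_n.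
  have [lin|lni|/eqP] := ltngtP i n; last by rewrite (negbTE i_n).
    by rewrite IH// subrr mul0r vabs0.
  rewrite vabsM vabsX.
  apply: le_trans (ler_wpM2r (exprn_ge0 _ (vabs_ge0 _)) (fC _)) _.
  rewrite -(subnK lni); set d := (i - n.+1)%N; rewrite !exprD.
  rewrite [X in X <= _](_ :
      _ = C / r ^+ n.+1 * vabs y ^+ n.+1 * (vabs y / r) ^+ d).
    rewrite ler_piMr// exprn_ile1 ?divr_ge0 ?vabs_ge0 ?ler_pdivrMr ?mul1r//.
    exact: ltW.
  by rewrite expr_div_n; field; rewrite !expf_neq0 ?gt_eqF.
rewrite fy subrr sub0r vabsN vabsM vabsX [vabs y ^+ n.+1]exprS mulrA.
rewrite ler_pM2r ?exprn_gt0//.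
rewrite mulrAC ler_pdivlMr ?exprn_gt0// -/c.
by rewrite leNgt [C * _]mulrC y_c.
Unshelve. all: by end_near. Qed.

End PowerSeries.

(** Some large powers of [p] are congruent to 1 modulo a high power of [q]; along them the iterates
    approach [F y] as well as [y]. *)
Lemma near_id_fixed (R : realType) (K : valuedField R) (rho : R) (p q : nat)
    (F : K -> K) (y : K) : prime p -> prime q -> p <> q ->
  vabs (q%:R : K) = (q%:R : R)^-1 -> 0 < rho -> near_id rho F ->
  vabs y <= rho ->
  (fun n => iter (p ^ n) F y : valued_space K) @ \oo --> (y : valued_space K) ->
  F y = y.
Proof.
move=> pp qp pq vq rho0 FI yr Fy.
apply/eqP; rewrite -subr_eq0 -vabs_eq0 -[_ == 0]negbK; apply/negP => d0.
have {}d0 : 0 < vabs (F y - y) by rewrite lt_neqAle eq_sym d0 vabs_ge0.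
have [N _ FN] := Fy _ (nbhsx_ballx (y : valued_space K) _ d0).
have [M HM] := exists_half_expr_lt (divr_gt0 d0 rho0).
(* The exponent [t * j] is a multiple of [t], as Euler's theorem requires, and is at least [N]; the
   modulus [q ^ j] has [j] at least [M]. *)
pose j := maxn N M; pose t := totient (q ^ j).
have t0 : (0 < t)%N by rewrite totient_gt0 expn_gt0 prime_gt0.
have cop : coprime p (q ^ j).
  by rewrite coprimeXr// prime_coprime// dvdn_prime2//; apply/eqP.
have congr1 : p ^ (t * j) = 1 %[mod q ^ j].
  by rewrite expnM -modnXm Euler_exp_totient// modnXm exp1n.
have pt0 : (0 < p ^ (t * j))%N by rewrite expn_gt0 prime_gt0.
have /le_lt_trans near1 := near_id_iter_congr1 qp vq FI yr pt0 congr1.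
have {near1}/near1 near1 : 2^-1 ^+ j * rho < vabs (F y - y).
  by rewrite -ltr_pdivlMr// HM// leq_maxr.
have /FN : (N <= t * j)%N by rewrite (leq_trans (leq_maxl N M))// leq_pmull.
rewrite /= ball_valuedE /= => near_y.
rewrite -vabsN opprB in near1.
rewrite -vabsN opprB in near_y.
(* Both distances are below [vabs (F y - y)], so the ultrametric inequality makes this number
   smaller than itself. *)
have := vabsD_lt near1 near_y.
by rewrite subrKA ltxx.
Qed.

Theorem proposition8p3 (R : realType) (p1 p2 : nat) (p1_neq_p2 : p1 <> p2)
    (K1 K2 : valuedField R)
    (padicK1 : padic_field p1 K1) (padicK2 : padic_field p2 K2)
    (f1 : nat -> K1) (f2 : nat -> K2)
    (f1_analytic : analytic f1) (f2_analytic : analytic f2)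
    (f1_tangent : tangent_to_id f1) (f2_tangent : tangent_to_id f2)
    (f1_neq_id : f1 <> ps_id) (f2_neq_id : f2 <> ps_id) :
  ~ locally_homeomorphic f1 f2.
Proof.
move=> [U1 [U2 [h [[U1_0 U1f1 f1U1] [U2_0 U2f2 f2U2]]]]].
move=> [g [h_bij hK h_cont g_cont]] h0 hf.
have [p1_prime _ _ vp1] := padicK1; have [p2_prime _ _ vp2] := padicK2.
have [rho1 [rho1_gt0 _ near1]] :=
  analytic_near_id f1_analytic f1_tangent U1_0 U1f1.
have [rho2 [rho2_gt0 ball2 near2]] :=
  analytic_near_id f2_analytic f2_tangent U2_0 U2f2.
have [hU _ h_surj] := h_bij.
have g0 : g (0 : K2) = (0 : K1).
  by rewrite -h0 hK// inE; exact: nbhs_singleton U1_0.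
have iterU n x : U1 x -> U1 (iter n (ps_eval f1) x).
  by move=> xU; elim: n => [//|n IH]; apply: f1U1.
have h_iter n x : U1 x ->
    h (iter n (ps_eval f1) x) = iter n (ps_eval f2) (h x).
  move=> xU; elim: n => [//|n IH].
  by rewrite !iterS hf ?IH// inE; exact: iterU.
have U2_00 : U2 (0 : K2) by exact: nbhs_singleton U2_0.
(* Points close to 0 in [K2] must come from the ball of [K1] on which the iterates of [f1] are
   controlled. *)
have g_near : \forall y \near ((0 : K2) : valued_space K2),
    U2 y -> vabs (g y : K1) < rho1.
  have /subspace_continuousP/(_ _ U2_00) := g_cont.
  rewrite [X in _ --> X]g0.
  move=> /(_ _ (nbhsx_ballx ((0 : K1) : valued_space K1) _ rho1_gt0)).
  rewrite /within /nbhs /=; apply: filterS => y /= + yU => /(_ yU).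
  by rewrite ball_valuedE /= sub0r vabsN.
have /nbhs_ballP[e /= e0 He] := g_near.
have fixed y : vabs (y : K2) <= Num.min rho2 (e / 2) ->
    ps_domain f2 y /\ ps_eval f2 y = y.
  rewrite le_min => /andP[y_rho y_e].
  have yU : U2 y by exact: ball2.
  split; first exact: U2f2.
  apply: (near_id_fixed (F := ps_eval f2) p1_prime p2_prime p1_neq_p2 vp2
    rho2_gt0 near2 y_rho).
  have [x xU hx] := h_surj _ yU.
  have gy : g y = x by rewrite -hx hK// inE.
  have x_rho : vabs (x : K1) <= rho1.
    rewrite -gy ltW// He// ball_valuedE /= sub0r vabsN.
    by apply: le_lt_trans y_e _; lra.
  (* This convergence is [p1]-adic; [h] then carries it to the orbit of [y] under [f2]. *)
  have x_lim : (fun n => iter (p1 ^ n) (ps_eval f1) x) @ \oo --> x.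
    apply/cvg_ballP => d d0.
    have [N HN] := exists_half_expr_lt (divr_gt0 d0 rho1_gt0).
    exists N => // n /HN; rewrite ltr_pdivlMr// => nd.
    rewrite ball_valuedE /= -vabsN opprB.
    exact: le_lt_trans (near_id_iter_pX p1_prime vp1 n near1 x_rho) nd.
  have -> : (fun n => iter (p1 ^ n) (ps_eval f2) y)
      = h \o (fun n => iter (p1 ^ n) (ps_eval f1) x).
    by apply/funext => n /=; rewrite h_iter// hx.
  have /subspace_continuousP/(_ _ xU) := h_cont; rewrite [X in _ --> X]hx.
  apply: cvg_comp.
  (* As [h] is continuous only within [U1], the convergence to [x] has to take place inside [U1],
     which invariance ensures. *)
  move=> A /= /x_lim[N _ AN]; exists N => // n /AN /=; apply; exact: iterU.
apply: f2_neq_id.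
apply: (ps_eval_id_eq p2_prime vp2 f2_analytic f2_tangent _ fixed).
by rewrite lt_min rho2_gt0 divr_gt0.
Qed.
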